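(* Let $K$ be an infinite field of characteristic different from $2$ and $3$, and let $A$ be a Bernstein algebra over $K$. Then $A$ contains a maximal algebraic ideal $\mathcal{I}(A)$. Furthermore, $\mathcal{I}(A)$ contains $A^2$, so that $A/\mathcal{I}(A)$ is a zero-multiplication algebra.
   Context: Algebras are not assumed associative, unital or finite-dimensional. A Bernstein algebra over $K$ is a commutative $K$-algebra $A$ with a nonzero algebra homomorphism $\omega:A\to K$ (the weight function) satisfying $(x^2)^2=\omega(x)^2x^2$ for all $x\in A$. $A^2$ is the subspace spanned by all products $xy$, $x,y\in A$. An element $a$ is algebraic if the subalgebra $\mathrm{alg}(a)$ generated by $a$ is finite-dimensional; an algebra or ideal is algebraic if all of its elements are algebraic. Maximality is with respect to inclusion among algebraic ideals of $A$. A zero-multiplication algebra is one in which all products are zero. *)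

(* Defs.v *)
From HB Require Import structures.
From mathcomp Require Import all_boot all_order all_algebra.
From mathcomp Require Import generic_quotient ring_quotient.
From mathcomp Require Import boolp classical_sets functions cardinality.

Set Implicit Arguments.
Unset Strict Implicit.
Unset Printing Implicit Defensive.

Import GRing.Theory.

Local Open Scope classical_set_scope.
Local Open Scope quotient_scope.
Local Open Scope ring_scope.

(* A (not necessarily associative, unital or finite-dimensional) K-algebra is
   an lmodType K together with a bilinear product on it. *)

Section Subspaces.
Context {K : fieldType} {V : lmodType K}.
Implicit Types S : set V.

Definition subspace S : Prop := submod_closed [in S].

Definition linear_span S : set V := smallest subspace S.

Definition finite_dimensional S : Prop :=
  exists n (b : 'I_n -> V), (forall i, S (b i)) /\
    forall x, S x -> exists c : 'I_n -> K, x = \sum_(i < n) c i *: b i.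

End Subspaces.

Section Algebras.
Context {K : fieldType} {A : lmodType K}.
Implicit Types (mul : {bilinear A -> A -> A}) (S : set A).

Definition subalgebra mul S : Prop :=
  subspace S /\ forall x y, S x -> S y -> S (mul x y).

Definition alg mul (a : A) : set A := smallest (subalgebra mul) [set a].

Definition algebraic mul : set A := [set a | finite_dimensional (alg mul a)].

Definition square mul : set A :=
  linear_span [set z | exists x y, z = mul x y].

Definition zero_multiplication mul : Prop := forall x y, mul x y = 0.

Definition weight mul (w : {scalar A}) : Prop :=
  (exists x, w x != 0) /\ forall x y, w (mul x y) = w x * w y.

Definition bernstein mul (w : {scalar A}) : Prop :=
  [/\ commutative mul, weight mul w
    & forall x, mul (mul x x) (mul x x) = w x ^+ 2 *: mul x x].

Record ideal mul := Ideal {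
  ideal_set :> set A;
  ideal_subspace : subspace ideal_set;
  ideal_mull : forall a x, ideal_set x -> ideal_set (mul a x);
  ideal_mulr : forall a x, ideal_set x -> ideal_set (mul x a) }.

Definition algebraic_ideal mul (I : ideal mul) : Prop :=
  I `<=` algebraic mul.

Definition maximal_algebraic_ideal mul (I : ideal mul) : Prop :=
  algebraic_ideal I /\
  forall J : ideal mul, algebraic_ideal J -> I `<=` J -> J = I :> set A.

End Algebras.

Section Quotient.
Context {K : fieldType} {A : lmodType K} {mul : {bilinear A -> A -> A}}.
Variable I : ideal mul.

Definition ideal_pred : A -> bool := [in (I : set A)].

Lemma ideal_predP x : reflect (ideal_set I x) (x \in ideal_pred).
Proof. by apply: (iffP idP) => [/set_mem|/mem_set]. Qed.

HB.instance Definition _ :=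
  GRing.isSubmodClosed.Build K A ideal_pred
    (ideal_subspace I : submod_closed ideal_pred).

Definition ideal_zmod : zmodClosed A := GRing.ZmodClosed.clone A ideal_pred _.

Definition quotient : Type := {ideal_quot ideal_zmod}.

HB.instance Definition _ := GRing.Zmodule.on quotient.
HB.instance Definition _ :=
  EqQuotient.copy quotient {ideal_quot ideal_zmod}.

Definition quotient_pi : A -> quotient := \pi_quotient.

Lemma quotient_eqP x y :
  reflect (ideal_set I (x - y)) (quotient_pi x == quotient_pi y).
Proof. by rewrite -Quotient.idealrBE; exact: ideal_predP. Qed.

Lemma quotient_repr (q : quotient) : quotient_pi (repr q) = q.
Proof. exact: reprK. Qed.

Lemma quotient_piD : {morph quotient_pi : x y / x + y}.
Proof. exact: Quotient.pi_add. Qed.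

Definition quotient_scale (c : K) (p : quotient) : quotient :=
  quotient_pi (c *: repr p).

Definition quotient_mul (p q : quotient) : quotient :=
  quotient_pi (mul (repr p) (repr q)).

Lemma repr_quotient_pi x : ideal_set I (repr (quotient_pi x) - x).
Proof. by apply/quotient_eqP; rewrite quotient_repr. Qed.

Lemma quotient_scale_pi c x :
  quotient_scale c (quotient_pi x) = quotient_pi (c *: x).
Proof.
apply/eqP/quotient_eqP; rewrite -scalerBr.
by apply/ideal_predP; rewrite rpredZ //; exact/ideal_predP/repr_quotient_pi.
Qed.

Lemma quotient_mul_pi x y :
  quotient_mul (quotient_pi x) (quotient_pi y) = quotient_pi (mul x y).
Proof.
apply/eqP/quotient_eqP; set x' := repr _; set y' := repr _.
have -> : mul x' y' - mul x y = mul (x' - x) y' + mul x (y' - y).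
  by rewrite linearBl linearBr addrA subrK.
apply/ideal_predP; rewrite rpredD //; apply/ideal_predP.
- exact/ideal_mulr/repr_quotient_pi.
- exact/ideal_mull/repr_quotient_pi.
Qed.

Fact quotient_scaleA a b p :
  quotient_scale a (quotient_scale b p) = quotient_scale (a * b) p.
Proof. by rewrite -[p]quotient_repr !quotient_scale_pi scalerA. Qed.

Fact quotient_scale1 : left_id 1 quotient_scale.
Proof. by move=> p; rewrite -[p]quotient_repr quotient_scale_pi scale1r. Qed.

Fact quotient_scaleDr : right_distributive quotient_scale +%R.
Proof.
move=> c p q; rewrite -[p]quotient_repr -[q]quotient_repr.
by rewrite -quotient_piD !quotient_scale_pi scalerDr quotient_piD.
Qed.

Fact quotient_scaleDl p : {morph quotient_scale^~ p : a b / a + b}.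
Proof.
move=> a b; rewrite -[p]quotient_repr !quotient_scale_pi.
by rewrite scalerDl quotient_piD.
Qed.

HB.instance Definition _ := GRing.Zmodule_isLmodule.Build K quotient
  quotient_scaleA quotient_scale1 quotient_scaleDr quotient_scaleDl.

Lemma quotient_piZ c x : quotient_pi (c *: x) = c *: quotient_pi x.
Proof. by rewrite -quotient_scale_pi. Qed.

Fact quotient_mul_linearl r : linear (quotient_mul^~ r).
Proof.
move=> c p q; rewrite -[p]quotient_repr -[q]quotient_repr -[r]quotient_repr.
by rewrite -quotient_piZ -quotient_piD !quotient_mul_pi linearPl
  quotient_piD quotient_piZ.
Qed.

Fact quotient_mul_linearr r : linear (quotient_mul r).
Proof.
move=> c p q; rewrite -[p]quotient_repr -[q]quotient_repr -[r]quotient_repr.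
by rewrite -quotient_piZ -quotient_piD !quotient_mul_pi linearPr
  quotient_piD quotient_piZ.
Qed.

HB.instance Definition _ :=
  bilinear_isBilinear.Build K quotient quotient quotient *:%R *:%R quotient_mul
    (quotient_mul_linearl, quotient_mul_linearr).

End Quotient.

Arguments quotient_pi {K A mul} I x.
Arguments quotient_mul {K A mul} I p q.

(* Main.v *)
(* Fix an idempotent [e] of weight 1 and let [A = Ke + U + V] be the Peirce
   decomposition, where [e] acts on [U] as 1/2 and on [V] as 0.  Comparing the
   coefficients of powers of [t] in the Bernstein identity at [e + t n], then
   at [n = u + t v], gives [U U <= V], [U V <= U], [V V <= U] and, among others,
   [u (u v) = 0], [U V^2 = 0], [U^2 V^2 = 0], [(u v)^2 = 0].  It follows that
   [(x y) y] is annihilated by [U], hence by [U^2], for [x] in [U] and [y] in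
   [V], so multiplication by [v] in [U^2] has cube zero on [U].
   Therefore an element [l e + u + v] of [A^2 = Ke + U + U^2] lies in the
   8-dimensional subalgebra spanned by [e], [u], [u v], [(u v) v], [u^2], [v],
   [v^2], [u^2 v].  Since every subspace containing [A^2] is an ideal, Zorn's
   lemma for subspaces of algebraic elements containing [A^2] concludes. *)
Require Import Defs.
From mathcomp Require Import all_boot all_order all_algebra.
From mathcomp Require Import boolp classical_sets functions cardinality.

Import GRing.Theory.
Local Open Scope classical_set_scope.
Local Open Scope ring_scope.

Set Implicit Arguments.
Unset Strict Implicit.
Unset Printing Implicit Defensive.

(** * Spans, finite dimension, and comparison of polynomial coefficients *)

Section Subspaces.
Context {K : fieldType} {V : lmodType K}.
Implicit Types (S : set V) (s : seq V).

Lemma subspaceP S :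
  subspace S <-> S 0 /\ forall a x y, S x -> S y -> S (a *: x + y).
Proof.
split=> -[S0 Sl]; split; try by [exact/mem_set|exact/set_mem].
- by move=> a x y Sx Sy; apply/set_mem/Sl; exact/mem_set.
- by move=> a x y /set_mem Sx /set_mem Sy; apply/mem_set/Sl.
Qed.

Lemma subspace0 S : subspace S -> S 0.
Proof. by case/subspaceP. Qed.

Lemma subspaceZD S a x y : subspace S -> S x -> S y -> S (a *: x + y).
Proof. by case/subspaceP=> _; exact. Qed.

Lemma subspaceZ S a x : subspace S -> S x -> S (a *: x).
Proof.
move=> Ss Sx; rewrite -[_ *: _]addr0; apply: subspaceZD => //.
exact: subspace0.
Qed.

Lemma subspaceD S x y : subspace S -> S x -> S y -> S (x + y).
Proof. by move=> *; rewrite -[x]scale1r; exact: subspaceZD. Qed.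

Lemma subspace_linear_span S : subspace (linear_span S).
Proof.
apply/subspaceP; split=> [T [/subspace0 //]|a x y Sx Sy T [Tsub ST]].
by apply: subspaceZD => //; [exact: Sx|exact: Sy].
Qed.

Lemma linear_span_cons x s z : linear_span [set` x :: s] z ->
  exists a, exists2 y, linear_span [set` s] y & z = a *: x + y.
Proof.
pose T := [set z |
  exists a, exists2 y, linear_span [set` s] y & z = a *: x + y].
apply: (@smallest_sub _ _ _ T).
  apply/subspaceP; split.
    exists 0, 0; first exact: (subspace0 (subspace_linear_span _)).
    by rewrite scale0r addr0.
  move=> c _ _ [a1 [y1 Sy1 ->]] [a2 [y2 Sy2 ->]].
  exists (c * a1 + a2), (c *: y1 + y2).
    by apply: (subspaceZD _ (subspace_linear_span _)).
  by rewrite scalerDr scalerDl scalerA addrACA.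
move=> y /=; rewrite inE => /orP[/eqP ->|sy].
  exists 1, 0; first exact: (subspace0 (subspace_linear_span _)).
  by rewrite scale1r addr0.
exists 0, y; last by rewrite scale0r add0r.
exact: sub_gen_smallest.
Qed.

Lemma linear_span_nil z : linear_span [set` [::] : seq V] z -> z = 0.
Proof.
apply: (@smallest_sub _ _ _ [set 0]) => //.
by apply/subspaceP; split=> // a _ _ -> ->; rewrite scaler0 addr0.
Qed.

(** [finite_dimensional] wants spanning vectors inside [S], which [s] need not provide. By induction
    [S] meets the span of the tail in a suitably spanned [T]; one vector of [S] outside that span
    completes the family. *)
Lemma finite_dimensional_sub S s :
  subspace S -> S `<=` linear_span [set` s] -> finite_dimensional S.
Proof.
elim: s S => [|b s IHs] S Ssub Ss.
  exists 0%N, (fun=> 0); split=> [[]//|x /Ss/linear_span_nil->].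
  by exists (fun=> 0); rewrite big_ord0.
pose T := S `&` linear_span [set` s].
have Tsub : subspace T.
  have ssub := subspace_linear_span [set` s].
  apply/subspaceP; split=> [|a x y [Sx sx] [Sy sy]].
    by split; [exact: subspace0|exact: (subspace0 ssub)].
  by split; [exact: subspaceZD|exact: (subspaceZD a ssub)].
have [m [c [cT cspan]]] := IHs T Tsub (@subIsetr _ _ _).
case: (pselect (S `<=` linear_span [set` s])) => [/IHs|]; first exact.
move=> /existsNP[x /not_implyP[Sx sNx]].
have [a [y sy xE]] := linear_span_cons (Ss x Sx).
have a0 : a != 0 by apply/eqP => a0; apply: sNx; rewrite xE a0 scale0r add0r.
exists m.+1, (fun i => if unlift ord0 i is Some j then c j else x); split.
  by move=> i; case: unliftP => // j _; case: (cT j).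
move=> z Sz; have [d [t st zE]] := linear_span_cons (Ss z Sz).
(* The factor [d / a] cancels the component of [z] along [b]. *)
have /cspan[f fE] : T (z - (d / a) *: x).
  split; first by rewrite -scaleNr addrC; exact: subspaceZD.
  rewrite zE xE scalerDr scalerA divfK // opprD addrACA subrr add0r.
  rewrite -scaleNr addrC.
  by apply: (subspaceZD _ (subspace_linear_span _)).
exists (fun i => if unlift ord0 i is Some j then f j else d / a).
rewrite big_ord_recl unlift_none; under eq_bigr do rewrite liftK.
by rewrite -fE addrC subrK.
Qed.

(** An infinite field has [n] distinct scalars [f j], and their Vandermonde matrix is invertible. *)
Lemma coef_eq0 n (c : nat -> V) : infinite_set [set: K] ->
  (forall t : K, \sum_(i < n) t ^+ i *: c i = 0) ->
  forall i, (i < n)%N -> c i = 0.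
Proof.
move=> /(infinite_set_fset n)[B _ nB] c0 i i_lt.
pose f j := (finmap.enum_fset B)`_j; pose k := Ordinal i_lt.
pose M := Vandermonde n (\row_(j < n) f j).
have Mu : M \in unitmx.
  rewrite unitmxE unitfE det_Vandermonde.
  apply/prodf_neq0 => p _; apply/prodf_neq0 => q pq.
  rewrite !mxE subr_eq0 nth_uniq ?finmap.fset_uniq ?gtn_eqF //;
    exact: leq_trans nB.
(* Weighting the evaluations by column [k] of the inverse matrix isolates [c k]. *)
have : \sum_(j < n) invmx M j k *: (\sum_(p < n) f j ^+ p *: c p) = 0.
  by apply: big1 => j _; rewrite c0 scaler0.
under eq_bigr do rewrite scaler_sumr.
rewrite exchange_big /=.
under eq_bigr => p _.
  under eq_bigr => j _ do rewrite scalerA mulrC.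
  rewrite -scaler_suml (_ : \sum_(j < n) _ = (p == k)%:R); last first.
    have /matrixP/(_ p k) := mulmxV Mu; rewrite !mxE => <-.
    by apply: eq_bigr => j _; rewrite !mxE.
  over.
rewrite (bigD1 k) //= eqxx scale1r big1 ?addr0 // => p /negPf ->.
by rewrite scale0r.
Qed.

Lemma eq_coef n (c d : nat -> V) : infinite_set [set: K] ->
  (forall t : K, \sum_(i < n) t ^+ i *: c i = \sum_(i < n) t ^+ i *: d i) ->
  forall i, (i < n)%N -> c i = d i.
Proof.
move=> Kinf cd i i_lt; apply/eqP; rewrite -subr_eq0; apply/eqP.
apply: (coef_eq0 (c := fun i => c i - d i) Kinf) i_lt => t.
under eq_bigr do rewrite scalerBr.
by rewrite sumrB cd subrr.
Qed.

End Subspaces.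

(** * Finitely spanned subalgebras and the Zorn argument *)

Section SpanAlgebra.
Context {K : fieldType} {A : lmodType K} (mul : {bilinear A -> A -> A}).

Lemma subalgebra_linear_span (S : set A) :
  (forall x y, S x -> S y -> linear_span S (mul x y)) ->
  subalgebra mul (linear_span S).
Proof.
move=> SM; have Ssub := subspace_linear_span S; split=> // x y Sx Sy.
have preim (f : {linear A -> A}) : (forall z, S z -> linear_span S (f z)) ->
    forall z, linear_span S z -> linear_span S (f z).
  move=> Sf; apply: (@smallest_sub _ _ _ [set z | linear_span S (f z)]) => //.
  apply/subspaceP; split=> [|a u v] /=.
    by rewrite linear0; exact: (subspace0 Ssub).
  by move=> Su Sv; rewrite linearP; exact: (subspaceZD a Ssub).
apply: (preim (mul x)) Sy => z Sz.
exact: (preim (applyr mul z) (fun t St => SM t z St Sz) x Sx).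
Qed.

Lemma alg_finite_dimensional (s : seq A) a :
  (forall x y, x \in s -> y \in s -> linear_span [set` s] (mul x y)) ->
  linear_span [set` s] a -> algebraic mul a.
Proof.
move=> sM sa; apply: (@finite_dimensional_sub _ _ _ s).
  apply/subspaceP; split=> [T [[/subspace0]]//|c x y ax ay T [Talg aT]].
  have [Tsub _] := Talg.
  by apply: subspaceZD => //; [exact: ax|exact: ay].
apply: smallest_sub; first exact: subalgebra_linear_span.
by move=> _ ->.
Qed.

Lemma maximal_algebraic_subspace : square mul `<=` algebraic mul ->
  exists I : ideal mul, maximal_algebraic_ideal I /\ square mul `<=` I.
Proof.
move=> sq_alg.
have sq_mul x y : square mul (mul x y).
  by apply: sub_gen_smallest; exists x, y.
(* Taking the union with [square mul] makes the empty chain harmless. *)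
pose P (X : set A) :=
  subspace (X `|` square mul) /\ X `|` square mul `<=` algebraic mul.
have [F FP Ftot|I [[Isub Ialg] Imax]] := @Zorn_bigcup _ P.
  split; last first.
    by move=> x [[X /FP[_ XP] Xx]|/sq_alg //]; apply: XP; left.
  have sqsub : subspace (square mul) := subspace_linear_span _.
  apply/subspaceP; split; first by right; exact: (subspace0 sqsub).
  have inX (X : set A) a x y : F X -> (X `|` square mul) x ->
      (X `|` square mul) y ->
      (\bigcup_(X in F) X `|` square mul) (a *: x + y).
    move=> FX Xx Xy; have [/subspaceP[_ /(_ a x y Xx Xy)] [Xz|sz] _] := FP X FX.
      by left; exists X.
    by right.
  move=> a x y [[X FX Xx]|sx] [[Y FY Yy]|sy].
  - have [XY|YX] := Ftot X Y FX FY.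
      by apply: (inX Y) => //; left => //; exact: XY.
    by apply: (inX X) => //; left => //; exact: YX.
  - by apply: (inX X) => //; [left|right].
  - by apply: (inX Y) => //; [right|left].
  - by right; exact: (subspaceZD a sqsub).
have sqI : square mul `<=` I.
  (* Otherwise this union would be strictly larger than [I] and still satisfy [P]. *)
  apply: contrapT => sqNI; apply: (Imax (I `|` square mul)).
    split; first by move=> x; left.
    by move=> IsI; apply: sqNI => x sx; apply: IsI; right.
  by rewrite /P -setUA setUid.
have IE : I `|` square mul = I by apply/setUidPl.
rewrite IE in Isub Ialg.
exists (Ideal Isub (fun a x _ => sqI _ (sq_mul a x))
                   (fun a x _ => sqI _ (sq_mul x a))).
(* An algebraic ideal [J] containing [I] contains [square mul], hence satisfies [P], so it cannot be
   strictly larger. *)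
split=> //; split=> // J Jalg IJ; apply/seteqP; split=> //.
apply: contrapT => JNI; apply: (Imax J); first by split.
have -> : P J = (subspace J /\ J `<=` algebraic mul).
  rewrite /P (_ : J `|` square mul = J) //.
  exact/setUidPl/(subset_trans sqI).
by split=> //; exact: ideal_subspace.
Qed.

End SpanAlgebra.

(** * Peirce decomposition at an idempotent of weight 1 *)

Section Bernstein.
Context {K : fieldType} {A : lmodType K} {mul : {bilinear A -> A -> A}}.
Context {w : {scalar A}} {e : A}.
Context (K_infinite : infinite_set [set: K]) (K_char2 : 2%N \notin [pchar K]).
Context (A_bernstein : bernstein mul w) (we : w e = 1) (ee : mul e e = e).

Local Notation "x ** y" := (mul x y) (at level 40, left associativity).

Let mulC : commutative mul. Proof. by case: A_bernstein. Qed.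
Let mulDl x y z : (x + y) ** z = x ** z + y ** z. Proof. exact: linearDl. Qed.
Let mulDr x y z : z ** (x + y) = z ** x + z ** y. Proof. exact: linearDr. Qed.
Let mulZl a x y : (a *: x) ** y = a *: (x ** y). Proof. exact: linearZl_LR. Qed.
Let mulZr a x y : x ** (a *: y) = a *: (x ** y). Proof. exact: linearZr_LR. Qed.
Let mul0l x : 0 ** x = 0. Proof. exact: linear0l. Qed.
Let mul0r x : x ** 0 = 0. Proof. exact: linear0r. Qed.
Let mulNr x y : x ** (- y) = - (x ** y). Proof. exact: linearNr. Qed.

Let wM x y : w (x ** y) = w x * w y.
Proof. by case: A_bernstein => _ [_]. Qed.

Let two_neq0 : 2%:R != 0 :> K.
Proof. by move: K_char2; rewrite inE. Qed.

Let double_inj (x y : A) : x + x = y + y -> x = y.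
Proof. by rewrite -!mulr2n -!scaler_nat => /(scalerI two_neq0). Qed.

Let double_eq0 (x : A) : x + x = 0 -> x = 0.
Proof. by move=> x0; apply: double_inj; rewrite x0 addr0. Qed.

Let coef_eq n (c d : nat -> A) :
  (forall t : K, \sum_(i < n) t ^+ i *: c i = \sum_(i < n) t ^+ i *: d i) ->
  forall i, (i < n)%N -> c i = d i.
Proof. exact: eq_coef. Qed.

Let sumE := (big_ord_recl, big_ord0, expr0, scale1r, expr1, scaler0, addr0).

Let addr3_double (x y z s : A) :
  x + y + z + (x + y + z) + s = x + x + s + (y + y) + (z + z).
Proof.
by rewrite addrACA [x + y + _]addrACA [LHS]addrAC [in LHS](addrAC _ _ s).
Qed.

Let sqr_binomial t x y :
  (x + t *: y) ** (x + t *: y)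
  = x ** x + t *: (x ** y + x ** y) + t ^+ 2 *: (y ** y).
Proof.
rewrite mulDl !mulDr !(mulZl, mulZr) scalerA (mulC y x) scalerDr expr2.
by rewrite !addrA.
Qed.

Let sqr_trinomial t x y z :
  (x + t *: y + t ^+ 2 *: z) ** (x + t *: y + t ^+ 2 *: z)
  = x ** x + t *: (x ** y + x ** y) + t ^+ 2 *: (x ** z + x ** z + y ** y)
    + t ^+ 3 *: (y ** z + y ** z) + t ^+ 4 *: (z ** z).
Proof.
have := sqr_binomial 1 (x + t *: y) (t ^+ 2 *: z).
rewrite !scale1r expr1n scale1r => ->; rewrite sqr_binomial.
rewrite !(mulDl, mulZl, mulZr) !scalerDr !scalerA -exprD -exprSr -!addrA.
congr (_ + (_ + (_ + _))).
rewrite addrCA; congr (_ + _).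
by rewrite [t ^+ 3 *: _ + (t ^+ 2 *: _ + _)]addrCA [LHS]addrCA.
Qed.

(* [e x = x / 2], written without division. *)
Definition half_part : set A := [set x | e ** x + e ** x = x].

Definition null_part : set A := [set x | e ** x = 0].

Local Notation U := half_part.
Local Notation V := null_part.

Let w_half u : U u -> w u = 0.
Proof.
rewrite /U /= => uE.
have : w u = w u + w u by rewrite -{1}uE linearD wM we mul1r.
by move/eqP; rewrite -subr_eq0 opprD addNKr oppr_eq0 => /eqP.
Qed.

Let w_null v : V v -> w v = 0.
Proof. by move=> vE; rewrite -[w v]mul1r -we -wM vE linear0. Qed.

Let half_null x : U x -> V x -> x = 0.
Proof. by rewrite /U /V /= => {2}<- ->; rewrite addr0. Qed.

Lemma subspace_half : subspace U.
Proof.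
apply/subspaceP; split=> [|a x y]; rewrite /U /= ?mul0r ?addr0 //.
by move=> xE yE; rewrite mulDr mulZr addrACA -scalerDr xE yE.
Qed.

Lemma subspace_null : subspace V.
Proof.
apply/subspaceP; split=> [|a x y]; rewrite /V /= ?mul0r //.
by move=> xE yE; rewrite mulDr mulZr xE yE scaler0 addr0.
Qed.

(** Since [(e + t n)^2 = e + t u + t^2 q] with [u = 2 e n] and [q = n^2], these are the coefficients
    of [t] to [t^4] in the Bernstein identity. *)
Lemma bernstein_kernel n : w n = 0 ->
  [/\ U (e ** n + e ** n),
      e ** (n ** n) + e ** (n ** n)
        + (e ** n + e ** n) ** (e ** n + e ** n) = n ** n,
      (e ** n + e ** n) ** (n ** n) = 0
    & (n ** n) ** (n ** n) = 0].
Proof.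
move=> wn; set u := e ** n + e ** n; set q := n ** n.
(* Lists hold coefficients by increasing degree; the default 0 of [nth] pads the shorter one. *)
have E : forall i, (i < 5)%N -> [:: e; e ** u + e ** u;
  e ** q + e ** q + u ** u; u ** q + u ** q; q ** q]`_i = [:: e; u; q]`_i.
  apply: coef_eq => t; rewrite !sumE /= /bump /= !addnE /=.
  case: A_bernstein => _ _ /(_ (e + t *: n)).
  have -> : w (e + t *: n) = 1 by rewrite linearD linearZ /= we wn mulr0 addr0.
  by rewrite expr1n scale1r sqr_binomial ee sqr_trinomial -/u -/q ee !addrA.
split.
- exact: (E 1%N).
- exact: (E 2%N).
- by apply: double_eq0; exact: (E 3%N).
- exact: (E 4%N).
Qed.

(** Expanding [g ((x + y)^2)] leaves [2 g (x y) = 0]. *)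
Let polarize (S : set A) (g : A -> A) x y :
  subspace S -> {morph g : a b / a + b} ->
  (forall z, S z -> g (z ** z) = 0) -> S x -> S y -> g (x ** y) = 0.
Proof.
move=> Ssub gD gS Sx Sy; apply: double_eq0.
have := gS _ (subspaceD Ssub Sx Sy).
by rewrite mulDl !mulDr !gD !gS // add0r addr0 (mulC y).
Qed.

Lemma half_null_kernel u v t : U u -> V v ->
  [/\ w (u + t *: v) = 0
    & e ** (u + t *: v) + e ** (u + t *: v) = u].
Proof.
move=> Uu Vv; split.
  by rewrite linearD linearZ /= (w_half Uu) (w_null Vv) mulr0 addr0.
by rewrite mulDr mulZr (Vv : _ = _) scaler0 addr0.
Qed.

(** Coefficients in [t] of the second identity of [bernstein_kernel] at [n = u + t v]; the next two
    lemmas treat the third and fourth identities likewise. *)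
Lemma half_null_sqr u v : U u -> V v ->
  [/\ V (u ** u), U (u ** v) & U (v ** v)].
Proof.
move=> Uu Vv.
have E : forall i, (i < 3)%N -> [:: e ** (u ** u) + e ** (u ** u) + u ** u;
    e ** (u ** v + u ** v) + e ** (u ** v + u ** v);
    e ** (v ** v) + e ** (v ** v)]`_i = [:: u ** u; u ** v + u ** v; v ** v]`_i.
  apply: coef_eq => t; rewrite !sumE /= /bump /= !addnE /=.
  have [wn eu] := half_null_kernel t Uu Vv.
  have [_ + _ _] := bernstein_kernel wn; rewrite eu sqr_binomial !addrA => <-.
  by rewrite !(mulDr _ _ e) !mulZr addr3_double !(mulDr _ _ e) !scalerDr !addrA.
split.
- by apply: double_eq0; apply: (addIr (u ** u)); rewrite add0r; exact: (E 0%N).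
- by have := E 1%N isT; rewrite /= mulDr addrACA => /double_inj.
- exact: (E 2%N).
Qed.

Lemma mul_half_sqr u v : U u -> V v ->
  [/\ u ** (u ** u) = 0, u ** (u ** v) = 0 & u ** (v ** v) = 0].
Proof.
move=> Uu Vv.
set q := [:: u ** (u ** u); u ** (u ** v + u ** v); u ** (v ** v)].
have q0 : forall i, (i < size q)%N -> q`_i = [::]`_i.
  apply: coef_eq => t; rewrite !sumE /= /bump /= !addnE /=.
  have [wn eu] := half_null_kernel t Uu Vv.
  have [_ _ + _] := bernstein_kernel wn; rewrite eu sqr_binomial.
  by rewrite !(mulDr, mulZr) !addrA.
split; [exact: (q0 0%N)| |exact: (q0 2%N)].
by apply: double_eq0; rewrite -mulDr; exact: (q0 1%N).
Qed.

Lemma sqr_half_null u v : U u -> V v ->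
  [/\ (u ** u) ** (u ** u) = 0, (u ** u) ** (u ** v) = 0,
      (u ** u) ** (v ** v) = 0 & (u ** v) ** (u ** v) = 0].
Proof.
move=> Uu Vv; set x := u ** u; set z := v ** v; pose y := u ** v + u ** v.
set q := [:: x ** x; x ** y + x ** y; x ** z + x ** z + y ** y;
  y ** z + y ** z; z ** z].
have q0 : forall i, (i < size q)%N -> q`_i = [::]`_i.
  apply: coef_eq => t; rewrite !sumE /= /bump /= !addnE /=.
  have [wn _] := half_null_kernel t Uu Vv.
  have [_ _ _] := bernstein_kernel wn; rewrite sqr_binomial sqr_trinomial.
  by rewrite !addrA.
have [Vx Uy Uz] := half_null_sqr Uu Vv.
have Uxz : U (x ** z) by rewrite mulC; have [] := half_null_sqr Uz Vx.
have Vyy : V (y ** y).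
  have : U y by exact: (subspaceD subspace_half).
  by move=> /half_null_sqr/(_ Vv)[].
(* The coefficient of [t^2] is [2 u^2 v^2 + 4 (u v)^2 = 0]. The first term is in [U], the second in
   [V], so both vanish. *)
have /eqP := q0 2%N isT; rewrite /= addrC addr_eq0 => /eqP yyE.
have yy0 : y ** y = 0.
  apply: half_null => //; rewrite yyE -scaleN1r.
  by apply: (subspaceZ _ subspace_half); exact: (subspaceD subspace_half).
split.
- exact: (q0 0%N).
- by apply: double_eq0; rewrite -mulDr; apply: double_eq0; exact: (q0 1%N).
- by apply: double_eq0; apply: oppr_inj; rewrite oppr0 -yyE.
- apply: double_eq0; rewrite -mulDr; apply: double_eq0.
  by rewrite -mulDl.
Qed.

(** * Peirce products and linearized identities *)

Lemma mul_half_half x y : U x -> U y -> V (x ** y).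
Proof.
apply: (polarize (g := mul e) subspace_half (fun a b => mulDr a b e)) => z Uz.
by have [] := half_null_sqr Uz (subspace0 subspace_null).
Qed.

Lemma mul_half_null u v : U u -> V v -> U (u ** v).
Proof. by move=> Uu Vv; have [] := half_null_sqr Uu Vv. Qed.

Lemma mul_null_null x y : V x -> V y -> U (x ** y).
Proof.
move=> Vx Vy; apply/eqP; rewrite -subr_eq0; apply/eqP; move: Vx Vy.
(* The zeros of this additive map are exactly [U], so [polarize] applies. *)
pose g z := e ** z + e ** z - z.
apply: (polarize (g := g) subspace_null) => [a b|z Vz]; rewrite /g.
  by rewrite mulDr opprD [X in X + _ = _]addrACA [LHS]addrACA.
have [_ _ ->] := half_null_sqr (subspace0 subspace_half) Vz.
by rewrite subrr.
Qed.

(** Linearization of [u (u v) = 0] in [u]. *)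
Lemma half_mul_null_skew x y v : U x -> U y -> V v ->
  x ** (y ** v) + y ** (x ** v) = 0.
Proof.
move=> Ux Uy Vv.
have [_ + _] := mul_half_sqr (subspaceD subspace_half Ux Uy) Vv.
rewrite !(mulDl, mulDr).
have [_ -> _] := mul_half_sqr Ux Vv; have [_ -> _] := mul_half_sqr Uy Vv.
by rewrite add0r addr0 addrC.
Qed.

Lemma half_mul_null_mul u x y : U u -> V x -> V y -> u ** (x ** y) = 0.
Proof.
move=> Uu.
apply: (polarize (g := mul u) subspace_null (fun a b => mulDr a b u)) => z Vz.
by have [] := mul_half_sqr Uu Vz.
Qed.

Lemma half_mul_half_mul_null u u' x y : U u -> U u' -> V x -> V y ->
  (u ** u') ** (x ** y) = 0.
Proof.
move=> Uu Uu'; apply: (polarize (g := mul (u ** u')) subspace_null)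
  => [a b|z Vz].
  exact: mulDr.
move: Uu Uu'.
apply: (polarize (g := fun a => a ** (z ** z)) subspace_half) => [a b|t Ut].
  exact: mulDl.
by have [] := sqr_half_null Ut Vz.
Qed.

Lemma half_null_mul_half_null x y v : U x -> U y -> V v ->
  (x ** v) ** (y ** v) = 0.
Proof.
move=> Ux Uy Vv; apply: double_eq0.
have [_ _ _] := sqr_half_null (subspaceD subspace_half Ux Uy) Vv.
rewrite !(mulDl, mulDr).
have [_ _ _ ->] := sqr_half_null Ux Vv; have [_ _ _ ->] := sqr_half_null Uy Vv.
by rewrite add0r addr0 [X in _ + X]mulC.
Qed.

(** This is the coefficient of [t] in [u u^2 = 0] at [u = x + t y]. *)
Lemma half_sqr_mul x y : U x -> U y ->
  (x ** x) ** y = - (x ** (x ** y) + x ** (x ** y)).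
Proof.
move=> Ux Uy; apply/eqP; rewrite -addr_eq0; apply/eqP.
set q := [:: x ** (x ** x); y ** (x ** x) + x ** (x ** y + x ** y);
   y ** (x ** y + x ** y) + x ** (y ** y); y ** (y ** y)].
suff: forall i, (i < size q)%N -> q`_i = [::]`_i.
  by move/(_ 1%N isT); rewrite /= mulDr mulC.
apply: coef_eq => t; rewrite !sumE /= /bump /= !addnE /=.
have [+ _ _] := mul_half_sqr
  (subspaceD subspace_half Ux (subspaceZ t subspace_half Uy))
  (subspace0 subspace_null).
rewrite sqr_binomial mulDl (mulDr _ _ x) (mulDr _ _ x) (mulDr _ _ (t *: y)).
rewrite (mulDr _ _ (t *: y)) !(mulZl, mulZr) !scalerA -expr2 -exprSr => <-.
rewrite !scalerDr !addrA; congr (_ + _); rewrite -!addrA; congr (_ + _).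
by rewrite [LHS]addrA [RHS]addrA [RHS]addrACA; congr (_ + _); exact: addrC.
Qed.

(** Full linearization of [u u^2 = 0]: the left side is symmetric and additive in [x] and [y], and
    [half_sqr_mul] makes it vanish for [x = y]. *)
Lemma half_cycle x y z : U x -> U y -> U z ->
  (x ** y) ** z + (x ** (y ** z) + y ** (x ** z)) = 0.
Proof.
move=> Ux Uy Uz; pose p a b := (a ** b) ** z + (a ** (b ** z) + b ** (a ** z)).
have pC a b : p a b = p b a.
  by rewrite /p (mulC a b); congr (_ + _); exact: addrC.
have pD a b c : p (a + b) c = p a c + p b c.
  by rewrite /p !(mulDl, mulDr) [X in _ + X = _]addrACA [LHS]addrACA.
have p0 a : U a -> p a a = 0 by move=> Ua; rewrite /p half_sqr_mul // addNr.
rewrite -[LHS]/(p x y); apply: double_eq0.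
have := p0 _ (subspaceD subspace_half Ux Uy).
by rewrite pD !(pC _ (x + y)) !pD !p0 // add0r addr0 (pC y x).
Qed.

(** * Algebraicity of the elements of [A^2] *)

(* A subspace containing [U * U] on which only the identities making
   [absorbed_algebraic] work are imposed; being given by linear conditions, it
   avoids writing elements of the span of [U * U] as sums of products. *)
Definition absorbed_part : set A := [set v | [/\ V v,
  forall x y, V x -> V y -> v ** (x ** y) = 0
& forall x y, U x -> V y -> v ** ((x ** y) ** y) = 0]].

Local Notation D := absorbed_part.

Lemma subspace_absorbed : subspace D.
Proof.
apply/subspaceP; split.
  by split=> *; rewrite ?mul0l //; exact: (subspace0 subspace_null).
move=> a x y [Vx x1 x2] [Vy y1 y2]; split=> [|p q Vp Vq|p q Up Vq].
- exact: (subspaceZD a subspace_null).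
- by rewrite mulDl mulZl x1 // y1 // scaler0 addr0.
- by rewrite mulDl mulZl x2 // y2 // scaler0 addr0.
Qed.

Lemma mul_half_absorbed u u' : U u -> U u' -> D (u ** u').
Proof.
move=> Uu Uu'; split=> [|x y Vx Vy|x y Ux Vy].
- exact: mul_half_half.
- exact: half_mul_half_mul_null.
(* By skew-symmetry [t ((x y) y) = - (x y) (t y)], and the right side is zero. *)
have cancel t : U t -> t ** ((x ** y) ** y) = 0.
  move=> Ut; have Uxy := mul_half_null Ux Vy.
  have := half_mul_null_skew Ut Uxy Vy.
  by rewrite half_null_mul_half_null // addr0.
have Ut : U ((x ** y) ** y).
  exact: (mul_half_null (mul_half_null Ux Vy) Vy).
(* With [z = (x y) y], this rewrites [(u u') z] through [u' z] and [u z], both zero by [cancel]. *)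
have := half_cycle Uu Uu' Ut.
by rewrite (cancel _ Uu) (cancel _ Uu') !mul0r !addr0.
Qed.

(* [e], [u], [uv], [(uv)v], [u^2], [v], [v^2] and [u^2 v] span a subalgebra. *)
Lemma absorbed_algebraic l u v : U u -> D v -> algebraic mul (l *: e + u + v).
Proof.
move=> Uu [Vv vVV vUV].
set x1 := u ** v; set x2 := x1 ** v; set y := u ** u; set z := v ** v.
set t := y ** v.
pose s := [:: e; u; x1; x2; y; v; z; t].
have [Ux1 Vy] : U x1 /\ V y.
  by split; [exact: mul_half_null|exact: mul_half_half].
have Ux2 : U x2 by exact: mul_half_null.
have [Uz Ut] : U z /\ U t by split; exact: mul_null_null.
have cancel r : U r -> r ** x2 = 0.
  move=> Ur; have := half_mul_null_skew Ur Ux1 Vv.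
  by rewrite half_null_mul_half_null // addr0.
have half r : U r -> e ** r = 2%:R^-1 *: r.
  by move=> {2}<-; rewrite -mulr2n -scaler_nat scalerA mulVf // scale1r.
have [_ yVV yUV] := mul_half_absorbed Uu Uu.
have zt r : U r -> r ** z = 0 /\ r ** t = 0.
  by move=> Ur; split; exact: half_mul_null_mul.
have [uy _ _] := mul_half_sqr Uu Vv; have [_ ux1 _] := mul_half_sqr Uu Vv.
have [yy yx1 _ x1x1] := sqr_half_null Uu Vv.
have table0 := (uy, ux1, yy, yx1, x1x1, yVV _ _ Vv Vv, yVV _ _ Vy Vv,
  vVV _ _ Vv Vv, vVV _ _ Vy Vv, yUV _ _ Uu Vv, vUV _ _ Uu Vv,
  (cancel _ Uu, cancel _ Ux1, cancel _ Ux2, cancel _ Uz, cancel _ Ut),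
  ((zt _ Uu).1, (zt _ Ux1).1, (zt _ Ux2).1, (zt _ Uz).1, (zt _ Ut).1),
  ((zt _ Uu).2, (zt _ Ux1).2, (zt _ Ux2).2, (zt _ Uz).2, (zt _ Ut).2)).
pose S := linear_span [set` s].
have Ssub : subspace S := subspace_linear_span _.
have S0 := subspace0 Ssub.
have Ss r : r \in s -> S r by move=> sr; exact: sub_gen_smallest.
apply: (@alg_finite_dimensional _ _ _ s); last first.
  rewrite -addrA; apply: (subspaceZD _ Ssub).
    by apply: Ss; rewrite !inE eqxx.
  by apply: (subspaceD Ssub); apply: Ss; rewrite !inE eqxx ?orbT.
have Se r : r \in s -> S (e ** r).
  have hS i : U i -> i \in s -> S (e ** i).
    by move=> Ui si; rewrite half //; apply: (subspaceZ _ Ssub); exact: Ss.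
  have nS i : V i -> S (e ** i) by move=> ->.
  have eS : S (e ** e) by rewrite ee; apply: Ss; rewrite !inE eqxx.
  rewrite !inE => /predU1P[->|
    /predU1P[->|/predU1P[->|/predU1P[->|
    /predU1P[->|/predU1P[->|/predU1P[->|/eqP->]]]]]]];
    by [|apply: nS|apply: hS => //; rewrite !inE eqxx ?orbT].
(* Up to commutativity, these are the only products of generators other than [e] not killed by
   [table0]; each is again a generator. *)
have [Sy Sx1 Sx2 Sz St] : [/\ S (u ** u), S (u ** v), S (x1 ** v), S (v ** v)
    & S (y ** v)].
  by split; apply: Ss; rewrite !inE eqxx ?orbT.
move=> p q ps qs; move: (ps) (qs); rewrite !inE.
case/predU1P => [->|ps']; first by move=> _; exact: Se.
case/predU1P => [->|]; first by rewrite mulC; exact: Se.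
move: ps' =>
  /predU1P[->|/predU1P[->|/predU1P[->|
    /predU1P[->|/predU1P[->|/predU1P[->|/eqP->]]]]]]
  /predU1P[->|/predU1P[->|/predU1P[->|
    /predU1P[->|/predU1P[->|/predU1P[->|/eqP->]]]]]];
  by [|rewrite table0|rewrite mulC|rewrite mulC table0].
Qed.

Lemma square_algebraic : square mul `<=` algebraic mul.
Proof.
pose P := [set a | exists l u v, [/\ U u, D v & a = l *: e + u + v]].
suff sqP : square mul `<=` P.
  by move=> a /sqP[l [u [v [Uu Dv ->]]]]; exact: absorbed_algebraic.
apply: smallest_sub => [|_ [x [y ->]]].
  apply/subspaceP; split.
    exists 0, 0, 0; split; rewrite ?scale0r ?addr0 //.
    - exact: (subspace0 subspace_half).
    - exact: (subspace0 subspace_absorbed).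
  move=> a _ _ [l [u [v [Uu Dv ->]]]] [l' [u' [v' [Uu' Dv' ->]]]].
  exists (a * l + l'), (a *: u + u'), (a *: v + v'); split.
  - exact: (subspaceZD a subspace_half).
  - exact: (subspaceZD a subspace_absorbed).
  - by rewrite !scalerDr scalerA scalerDl addrACA [X in X + _ = _]addrACA.
(* Subtracting [w a *: e] gives [n] in the kernel of [w]; then [2 e n] is in [U], and
   [e (2 e n) = e n] puts [n - 2 e n] in [V]. *)
have peirce a : exists l u v, [/\ U u, V v & a = l *: e + (u + v)].
  pose n := a - w a *: e; pose u := e ** n + e ** n.
  have wn : w n = 0 by rewrite linearB linearZ /= we mulr1 subrr.
  have [Uu _ _ _] := bernstein_kernel wn.
  exists (w a), u, (n - u); split=> //.
    by rewrite /V /= mulDr mulNr (double_inj (Uu : _ = u)) subrr.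
  by rewrite [u + _]addrC subrK addrC subrK.
have [l [u [v [Uu Vv ->]]]] := peirce x.
have [l' [u' [v' [Uu' Vv' ->]]]] := peirce y.
have eU r : U r -> U (e ** r) by move=> Ur; rewrite /U /= -mulDr (Ur : _ = r).
(* In the expanded product, [u u'] is the only term in [V]; the terms [e v'] and [e v] vanish and
   [v v'] falls in [U]. *)
exists (l * l'),
  (l *: (e ** u') + l' *: (e ** u) + (u ** v' + u' ** v + v ** v')),
  (u ** u').
split; last 1 first.
- rewrite !(mulDl, mulDr, mulZl, mulZr) ee scalerA.
  rewrite (mulC u e) (mulC v e) (mulC v u') (Vv : _ = _) (Vv' : _ = _).
  rewrite !scaler0 addr0 add0r.
  by rewrite [LHS](AC (2*((1*2)*2)) ((1*((2*3)*((5*6)*7)))*4)).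
- apply: (subspaceD subspace_half).
    by apply: (subspaceD subspace_half);
      apply: (subspaceZ _ subspace_half); exact: eU.
  apply: (subspaceD subspace_half); last exact: mul_null_null.
  by apply: (subspaceD subspace_half); exact: mul_half_null.
- exact: mul_half_absorbed.
Qed.

End Bernstein.

Theorem theorem0p1 (K : fieldType)
    (K_infinite : infinite_set [set: K])
    (K_char2 : 2%N \notin [pchar K]) (K_char3 : 3%N \notin [pchar K])
    (A : lmodType K) (mul : {bilinear A -> A -> A}) (w : {scalar A})
    (A_bernstein : bernstein mul w) :
  exists I : ideal mul,
    [/\ maximal_algebraic_ideal I,
        square mul `<=` I
      & zero_multiplication (quotient_mul I : {bilinear _ -> _ -> _})].
Proof.
(* For [x] of weight 1 the Bernstein identity says that [x^2] is idempotent. *)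
have [e we ee] : exists2 e, w e = 1 & mul e e = e.
  case: (A_bernstein) => _ [[a wa] wM] bern.
  pose x := (w a)^-1 *: a.
  have wx : w x = 1 by rewrite /x linearZ /= mulVf.
  by exists (mul x x); rewrite ?wM ?bern wx ?mulr1 // expr1n scale1r.
have [I [Imax sqI]] := maximal_algebraic_subspace
  (square_algebraic K_infinite K_char2 A_bernstein we ee).
exists I; split=> // p q.
rewrite -[p]quotient_repr -[q]quotient_repr.
rewrite [LHS](quotient_mul_pi I (repr p) (repr q)).
have /eqP pi_mul0 : quotient_pi I (mul (repr p) (repr q)) == quotient_pi I 0.
  apply/quotient_eqP; rewrite subr0; apply: sqI; apply: sub_gen_smallest.
  by exists (repr p), (repr q).
(* The class of 0 is the zero of the quotient, because it equals its own double. *)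
rewrite pi_mul0; apply: (addrI (quotient_pi I 0)).
by rewrite -quotient_piD !addr0.
Qed.
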